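(* Let $\boldsymbol{\mathcal Y}\in\mathbb{R}^{p_1\times\cdots\times p_d}$. Run TTOI on $\boldsymbol{\mathcal Y}$ with input ranks $(r_1,\dots,r_{d-1})$, and let $\widehat{\boldsymbol{\mathcal X}}^{(t)}$ be the outcome after the $t$th iteration. Then for any $t\ge1$, $$\|\boldsymbol{\mathcal Y}\|_{\mathrm F}^2-\|\widehat{\boldsymbol{\mathcal X}}^{(t+1)}\|_{\mathrm F}^2\le\|\boldsymbol{\mathcal Y}\|_{\mathrm F}^2-\|\widehat{\boldsymbol{\mathcal X}}^{(t)}\|_{\mathrm F}^2$$ and $$\|\boldsymbol{\mathcal Y}-\widehat{\boldsymbol{\mathcal X}}^{(t+1)}\|_{\mathrm F}^2=\|\boldsymbol{\mathcal Y}\|_{\mathrm F}^2-\|\widehat{\boldsymbol{\mathcal X}}^{(t+1)}\|_{\mathrm F}^2 .$$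
   Context: Throughout $d\ge2$, $p_1,\dots,p_d$ and $r_1,\dots,r_{d-1}$ are positive integers, $r_0=r_d=1$, and it is understood that $r_k\le r_{k-1}p_k$ and $r_{k-1}\le p_kr_k$ for all $k$, so that all matrices of singular vectors below exist. $\|\cdot\|_{\mathrm F}$ is the Frobenius norm (entrywise, for matrices and tensors). $\mathrm{SVD}^L_r(A)$ and $\mathrm{SVD}^R_r(A)$ are the matrices with orthonormal columns consisting of the leading $r$ left, respectively right, singular vectors of $A$ (any choice in case of ties). $U\otimes V$ is the usual Kronecker product, with blocks $U_{ij}V$. The sequential unfolding $[\boldsymbol{\mathcal X}]_k\in\mathbb{R}^{(p_1\cdots p_k)\times(p_{k+1}\cdots p_d)}$ has entry $\boldsymbol{\mathcal X}_{i_1,\dots,i_d}$ at row $i_1+(i_2-1)p_1+\cdots+(i_k-1)p_1\cdots p_{k-1}$ and column $i_{k+1}+(i_{k+2}-1)p_{k+1}+\cdots+(i_d-1)p_{k+1}\cdots p_{d-1}$. $\mathrm{Reshape}$ of matrices is column-major: for $A\in\mathbb{R}^{q_1\times q_2q_3}$ and $\widetilde A\in\mathbb{R}^{q_1q_2\times q_3}$, $\widetilde A=\mathrm{Reshape}(A,q_1q_2,q_3)$ and $A=\mathrm{Reshape}(\widetilde A,q_1,q_2q_3)$ iff $\widetilde A_{(i_2-1)q_1+i_1,i_3}=A_{i_1,(i_3-1)q_2+i_2}$ for all indices. Sequential products. For $M_i\in\mathbb{R}^{(p_ir_{i-1})\times r_i}$ ($1\le i\le d-1$): $M_{\mathrm{prod},1}^{(L)}=M_1$,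 $M_{\mathrm{prod},k+1}^{(L)}=(I_{p_{k+1}}\otimes M_{\mathrm{prod},k}^{(L)})M_{k+1}$. For $B_j\in\mathbb{R}^{(p_jr_j)\times r_{j-1}}$ ($2\le j\le d$): $B_{\mathrm{prod},d}^{(R)}=B_d$, $B_{\mathrm{prod},k}^{(R)}=(B_{\mathrm{prod},k+1}^{(R)}\otimes I_{p_k})B_k$. TTOI (tensor-train orthogonal iteration) with input $\boldsymbol{\mathcal Y}\in\mathbb{R}^{p_1\times\cdots\times p_d}$ and ranks $r_1,\dots,r_{d-1}$ produces iterates $\widehat{\boldsymbol{\mathcal X}}^{(t)}$, $t=0,1,2,\dots$: Initialization ($t=0$): $R_1^{(0)}=[\boldsymbol{\mathcal Y}]_1$; for $k=1,\dots,d-1$, $\widehat U_k^{(0)}=\mathrm{SVD}^L_{r_k}(R_k^{(0)})$, $\widetilde R_k^{(0)}=\widehat U_k^{(0)\top}R_k^{(0)}$, and if $k<d-1$, $R_{k+1}^{(0)}=\mathrm{Reshape}(\widetilde R_k^{(0)},r_kp_{k+1},p_{k+2}\cdots p_d)$. Then $[\widehat{\boldsymbol{\mathcal X}}^{(0)}]_{d-1}=(\widehat U^{(0)})_{\mathrm{prod},d-1}^{(L)}\widetilde R_{d-1}^{(0)}$. Backward update ($t$ odd): $\widehat V_d^{(t)}=\mathrm{SVD}^R_{r_{d-1}}(\widetilde R_{d-1}^{(t-1)})$; for $k=d-1,\dots,2$, $\widehat V_k^{(t)}=\mathrm{SVD}^R_{r_{k-1}}\bigl(\widetilde R_{k-1}^{(t-1)}((\widehat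 V^{(t)})_{\mathrm{prod},k+1}^{(R)}\otimes I_{p_k})\bigr)$. Then $[\widehat{\boldsymbol{\mathcal X}}^{(t)}]_1=[\boldsymbol{\mathcal Y}]_1(\widehat V^{(t)})_{\mathrm{prod},2}^{(R)}(\widehat V^{(t)})_{\mathrm{prod},2}^{(R)\top}$. Forward update ($t\ge2$ even): $R_1^{(t)}=[\boldsymbol{\mathcal Y}]_1$; for $k=1,\dots,d-1$, $\widehat U_k^{(t)}=\mathrm{SVD}^L_{r_k}\bigl(R_k^{(t)}(\widehat V^{(t-1)})_{\mathrm{prod},k+1}^{(R)}\bigr)$, $\widetilde R_k^{(t)}=\widehat U_k^{(t)\top}R_k^{(t)}$, and if $k<d-1$, $R_{k+1}^{(t)}=\mathrm{Reshape}(\widetilde R_k^{(t)},r_kp_{k+1},p_{k+2}\cdots p_d)$. Then $[\widehat{\boldsymbol{\mathcal X}}^{(t)}]_{d-1}=(\widehat U^{(t)})_{\mathrm{prod},d-1}^{(L)}\widetilde R_{d-1}^{(t)}$. *)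

(* Defs.v *)
From HB Require Import structures.
From mathcomp Require Import all_boot all_order all_algebra.
From mathcomp Require Import reals.
From mathcomp Require Export mxtens.

Set Implicit Arguments.
Unset Strict Implicit.
Unset Printing Implicit Defensive.

Import Order.TTheory GRing.Theory Num.Theory.
Local Open Scope ring_scope.

(* Modes, dimensions and ranks carry their 1-based mathematical indices:
   p k is meaningful for 1 <= k <= d and r k for 0 <= k <= d. The Kronecker
   product is tensmx (notation *t); mxtens_index (i, j) is the index i * n + j,
   so the second component is the fast one. *)

(** * Dimensions of the unfoldings *)

(* p_1 ... p_k *)
Fixpoint pre (p : nat -> nat) (k : nat) : nat :=
  if k is k'.+1 then (p k * pre p k')%N else 1%N.

(* p_(k+1) ... p_(k+n) *)
Fixpoint sufn (p : nat -> nat) (k n : nat) : nat :=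
  if n is n'.+1 then (sufn p k.+1 n' * p k.+1)%N else 1%N.

(* p_(k+1) ... p_d *)
Definition suf (d : nat) (p : nat -> nat) (k : nat) : nat := sufn p k (d - k).

Lemma suf_rec d p k : (k < d)%N -> suf d p k = (suf d p k.+1 * p k.+1)%N.
Proof. by move=> lt_kd; rewrite /suf -[(d - k)%N]prednK ?subn_gt0// subnS. Qed.

Lemma pre1E p (r : nat -> nat) : r 0%N = 1%N -> pre p 1 = (p 1 * r 0)%N.
Proof. by move=> ->. Qed.

(** * Tensors *)

(* The l-th component (l : 'I_d) of a multi-index is i_(l+1) - 1. *)
Notation multi_index d p := {dffun forall l : 'I_d, 'I_(p l.+1)}.
Notation tensor R d p := {ffun multi_index d p -> R}.

Definition frob (R : realType) d (p : nat -> nat) (X : tensor R d p) : R :=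
  Num.sqrt (\sum_I X I ^+ 2).

Definition row_pos d (p : nat -> nat) (k : nat) (I : multi_index d p) : nat :=
  (\sum_(l < d | l < k) I l * \prod_(m < d | m < l) p m.+1)%N.

Definition col_pos d (p : nat -> nat) (k : nat) (I : multi_index d p) : nat :=
  (\sum_(l < d | k <= l) I l * \prod_(m < d | k <= m < l) p m.+1)%N.

(* Exactly one multi-index contributes to each entry, by uniqueness of
   mixed-radix expansions. *)
Definition unfolding (R : realType) d p (k : nat) (X : tensor R d p) :
    'M[R]_(pre p k, suf d p k) :=
  \matrix_(i, j) \sum_(I | (row_pos k I == i) && (col_pos k I == j)) X I.

(* Reshape(A, q1 q2, q3), with the products of dimensions written slow index
   first. *)
Definition reshape_mx (R : realType) q1 q2 q3 (A : 'M[R]_(q1, q3 * q2)) :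
    'M[R]_(q2 * q1, q3) :=
  \matrix_(a, i3) A (mxtens_unindex a).2
                    (mxtens_index (i3, (mxtens_unindex a).1)).

(* Makes the mode k+1 explicit in the columns of a matrix whose columns are
   indexed by the modes k+1, ..., d. *)
Definition split_cols (R : realType) d p k (lt_kd : (k < d)%N) m
    (A : 'M[R]_(m, suf d p k)) : 'M[R]_(m, suf d p k.+1 * p k.+1) :=
  castmx (erefl m, suf_rec p lt_kd) A.

(** * Singular vectors *)

Record is_svd (R : realType) m n (A : 'M[R]_(m, n))
    (U : 'M[R]_m) (s : nat -> R) (V : 'M[R]_n) : Prop := IsSvd {
  svd_orthoU : U^T *m U = 1%:M;
  svd_orthoV : V^T *m V = 1%:M;
  svd_ge0 : forall i, 0 <= s i;
  svd_noninc : forall i j, (i <= j)%N -> s j <= s i;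
  svd_decomp : A = U *m (\matrix_(i, j) (s i *+ (i == j :> nat))) *m V^T }.

(* Ur (resp. Vr) is a possible value of SVD^L_r(A) (resp. SVD^R_r(A)). *)
Definition is_svdL (R : realType) m n (r : nat) (A : 'M[R]_(m, n))
    (Ur : 'M[R]_(m, r)) : Prop :=
  exists (le_rm : (r <= m)%N) (U : 'M[R]_m) (s : nat -> R) (V : 'M[R]_n),
    is_svd A U s V /\ Ur = colsub (widen_ord le_rm) U.

Definition is_svdR (R : realType) m n (r : nat) (A : 'M[R]_(m, n))
    (Vr : 'M[R]_(n, r)) : Prop :=
  exists (le_rn : (r <= n)%N) (U : 'M[R]_m) (s : nat -> R) (V : 'M[R]_n),
    is_svd A U s V /\ Vr = colsub (widen_ord le_rn) V.

(** * Sequential products *)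

(* M^(L)_(prod,k). The recursion starts at the empty product k = 0, a 1 x r_0
   matrix with entries 1: since r_0 = 1 this is the identity of size 1, whence
   M^(L)_(prod,1) = M_1. *)
Fixpoint lprod (R : realType) (p r : nat -> nat)
    (M : forall k, 'M[R]_(p k * r k.-1, r k)) (k : nat) : 'M[R]_(pre p k, r k) :=
  if k is k'.+1 then ((1%:M : 'M[R]_(p k'.+1)) *t lprod M k') *m M k'.+1
  else const_mx 1.

(* The product of B_(k+1), ..., B_(k+n); the empty product is the 1 x r_k
   matrix with entries 1, used only for k = d, where r_d = 1. *)
Fixpoint rprodn (R : realType) (p r : nat -> nat)
    (B : forall k, 'M[R]_(r k * p k, r k.-1)) (k n : nat) :
    'M[R]_(sufn p k n, r k) :=
  if n is n'.+1 then (rprodn B k.+1 n' *t (1%:M : 'M[R]_(p k.+1))) *m B k.+1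
  else const_mx 1.

(* B^(R)_(prod,k), for 1 <= k <= d + 1; B^(R)_(prod,d) = B_d, and
   B^(R)_(prod,d+1) is the identity of size 1. *)
Definition rprod (R : realType) (d : nat) (p r : nat -> nat)
    (B : forall k, 'M[R]_(r k * p k, r k.-1)) (k : nat) :
    'M[R]_(suf d p k.-1, r k.-1) :=
  rprodn B k.-1 (d - k.-1).

(** * Tensor-train orthogonal iteration *)

(* A run of TTOI on Y, for some choice of the singular vectors. The entries of
   Uhat, Rmat, Rtil at odd t, of Vhat at even t, and at values of k outside the
   ranges below are irrelevant. *)
Record ttoi_run (R : realType) (d : nat) (p r : nat -> nat)
    (r0 : r 0%N = 1%N) (Y : tensor R d p) : Type := TtoiRun {
  Uhat : nat -> forall k, 'M[R]_(p k * r k.-1, r k);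
  Vhat : nat -> forall k, 'M[R]_(r k * p k, r k.-1);
  Rmat : nat -> forall k, 'M[R]_(p k * r k.-1, suf d p k);
  Rtil : nat -> forall k, 'M[R]_(r k, suf d p k);
  Xhat : nat -> tensor R d p;

  (* common to the initialization and the forward updates *)
  ttoi_R1 : forall t, ~~ odd t ->
    Rmat t 1 = castmx (pre1E p r0, erefl _) (unfolding 1 Y);
  ttoi_Rtil : forall t k, ~~ odd t -> (1 <= k < d)%N ->
    Rtil t k = (Uhat t k)^T *m Rmat t k;
  ttoi_RS : forall t k (lt_kd : (k < d)%N), ~~ odd t -> (1 <= k < d.-1)%N ->
    Rmat t k.+1 = reshape_mx (split_cols lt_kd (Rtil t k));
  ttoi_X_forward : forall t, ~~ odd t ->
    unfolding d.-1 (Xhat t) = lprod (Uhat t) d.-1 *m Rtil t d.-1;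

  ttoi_U_init : forall k, (1 <= k < d)%N -> is_svdL (Rmat 0 k) (Uhat 0 k);
  ttoi_U_forward : forall t k, ~~ odd t -> (2 <= t)%N -> (1 <= k < d)%N ->
    is_svdL (Rmat t k *m rprod d (Vhat t.-1) k.+1) (Uhat t k);

  (* k + 1 runs over 2, ..., d; for k + 1 = d the factor on the right of Rtil
     is the identity of size p_d *)
  ttoi_V_backward : forall t k (lt_kd : (k < d)%N), odd t -> (1 <= k)%N ->
    is_svdR (split_cols lt_kd (Rtil t.-1 k) *m
               (rprod d (Vhat t) k.+2 *t (1%:M : 'M[R]_(p k.+1))))
            (Vhat t k.+1);
  ttoi_X_backward : forall t, odd t ->
    unfolding 1 (Xhat t) =
      unfolding 1 Y *m rprod d (Vhat t) 2 *m (rprod d (Vhat t) 2)^T }.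

(* Main.v *)
Require Import Defs.
From HB Require Import structures.
From mathcomp Require Import all_boot all_order all_algebra.
From mathcomp Require Import reals.

Import Order.TTheory GRing.Theory Num.Theory.
Local Open Scope ring_scope.

(** Write Y_k for the k-th unfolding of Y, L_k and B_k for the left and right
sequential products of the singular vectors at hand, and call energy the squared
Frobenius norm.

The outcome of a sweep is an orthogonal projection of Y: its last unfolding is
L L^T Y_(d-1) with L = L_(d-1) after a forward sweep, its first one is Y_1 B B^T
with B = B_2 after a backward sweep, and L, B have orthonormal columns. This gives
the equality by Pythagoras ([frob_Xhat_residual]). For a forward sweep it rests on
Rtil_k = L_k^T Y_k ([Rtil_lprod]), which holds because reshaping turns the k-th
unfolding of a tensor into the next one ([reshape_unfolding]) and left
multiplication by M into left multiplication by 1 *t M ([reshape_mulmxl]).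

It remains to see that the energy of the outcome, which is that of
Rtil_(d-1) = L^T Y_(d-1) or of Y_1 B, does not decrease from one sweep to the
next. Two consecutive sweeps are joined by the mixed energies of R_k B_(k+1) and
Rtil_k B_(k+1), where R_k, Rtil_k = U_k^T R_k come from the forward sweep and
B_(k+1) = (B_(k+2) *t 1) V_(k+1) from the backward one. They are ordered in a
chain from Y_1 B_2 = R_1 B_2 (up to a cast) to Rtil_(d-1), whose links are:

- from R_k B_(k+1) to Rtil_k B_(k+1), multiplication by U_k^T;
- from Rtil_k (B_(k+2) *t 1) to Rtil_k B_(k+1), multiplication by V_(k+1);
- Rtil_k (B_(k+2) *t 1) and R_(k+1) B_(k+2) are equal up to reshaping
  ([sqnorm_Rtil_Rmat]).

Multiplication by U_k^T or V_(k+1) never increases the energy. Moreover, it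
preserves it in the sweep that computes the factor: in a forward sweep U_k
consists of r_k left singular vectors of R_k B_(k+1), which has r_k columns, and
in a backward sweep V_(k+1) consists of r_k right singular vectors of
Rtil_k (B_(k+2) *t 1), which has r_k rows; such a truncation loses nothing
([sqnorm_svdL], [sqnorm_svdR]). So along the chain, one kind of link is an
equality and the other one an inequality, in the direction that favours the later
of the two sweeps ([forward_sweep_le], [backward_sweep_le]). *)

(** * Energy of matrices and orthonormal columns *)

(** The trace form makes products with orthonormal matrices cancel by mere
associativity; [sqnormE] recovers the sum of the squared entries. *)
Definition sqnorm {R : realDomainType} {m n} (A : 'M[R]_(m, n)) : R :=
  \tr (A^T *m A).

Lemma sqnormE {R : realDomainType} {m n} (A : 'M[R]_(m, n)) :
  sqnorm A = \sum_i \sum_j A i j ^+ 2.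
Proof.
rewrite exchange_big; apply: eq_bigr => j _; rewrite !mxE.
by apply: eq_bigr => i _; rewrite mxE expr2.
Qed.

Lemma sqnorm_ge0 {R : realDomainType} {m n} (A : 'M[R]_(m, n)) : 0 <= sqnorm A.
Proof.
by rewrite sqnormE; do 2!apply: sumr_ge0 => ? _; apply: sqr_ge0.
Qed.

Lemma sqnorm_tr {R : realDomainType} {m n} (A : 'M[R]_(m, n)) :
  sqnorm A^T = sqnorm A.
Proof. by rewrite /sqnorm trmxK mxtrace_mulC. Qed.

Lemma sqnorm_cast {R : realDomainType} {m n m' n'} (e : (m = m') * (n = n'))
    (A : 'M[R]_(m, n)) : sqnorm (castmx e A) = sqnorm A.
Proof. by case: e => e1 e2; subst m' n'; rewrite castmx_id. Qed.

Lemma sqnorm_isometry {R : realDomainType} {m q n} (U : 'M[R]_(m, q))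
    (A : 'M[R]_(q, n)) : U^T *m U = 1%:M -> sqnorm (U *m A) = sqnorm A.
Proof.
by move=> UU; rewrite /sqnorm trmx_mul mulmxA -(mulmxA A^T) UU mulmx1.
Qed.

(** Pythagoras: U U^T A is the orthogonal projection of A on the column space of
U, and its energy is that of U^T A. *)
Lemma sqnorm_residual {R : realDomainType} {m q n} (U : 'M[R]_(m, q))
    (A : 'M[R]_(m, n)) : U^T *m U = 1%:M ->
  sqnorm (A - U *m (U^T *m A)) = sqnorm A - sqnorm (U^T *m A).
Proof.
move=> UU; rewrite /sqnorm [(_ - _)^T]linearB /= mulmxBl !mulmxBr.
rewrite !trmx_mul !trmxK !mulmxA -(mulmxA (A^T *m U) U^T U) UU mulmx1.
by rewrite subrr subr0 raddfB.
Qed.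

Lemma sqnorm_mul_trmx_le {R : realDomainType} {m q n} (U : 'M[R]_(m, q))
    (A : 'M[R]_(m, n)) : U^T *m U = 1%:M -> sqnorm (U^T *m A) <= sqnorm A.
Proof. by move=> UU; rewrite -subr_ge0 -sqnorm_residual// sqnorm_ge0. Qed.

Lemma sqnorm_mul_le {R : realDomainType} {m q n} (A : 'M[R]_(n, m))
    (V : 'M[R]_(m, q)) : V^T *m V = 1%:M -> sqnorm (A *m V) <= sqnorm A.
Proof.
by move=> VV; rewrite -sqnorm_tr trmx_mul -(sqnorm_tr A) sqnorm_mul_trmx_le.
Qed.

Lemma tens_scalar1 {R : comPzRingType} m n :
  (1%:M : 'M[R]_m) *t (1%:M : 'M[R]_n) = 1%:M.
Proof.
apply/matrixP => i j; case: (mxtens_indexP i) => i1 i2.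
case: (mxtens_indexP j) => j1 j2; rewrite tensmxE !mxE.
rewrite (can_eq (@mxtens_indexK _ _)) xpair_eqE.
by case: eqP; case: eqP; rewrite ?mulr1 ?mulr0 ?mul0r.
Qed.

Lemma orthonormal_mul {R : realDomainType} {m n q} (U : 'M[R]_(m, n))
    (V : 'M[R]_(n, q)) :
  U^T *m U = 1%:M -> V^T *m V = 1%:M -> (U *m V)^T *m (U *m V) = 1%:M.
Proof. by move=> UU VV; rewrite trmx_mul mulmxA -(mulmxA V^T) UU mulmx1. Qed.

Lemma orthonormal_tens {R : realDomainType} {m n m' n'} (U : 'M[R]_(m, n))
    (V : 'M[R]_(m', n')) :
  U^T *m U = 1%:M -> V^T *m V = 1%:M -> (U *t V)^T *m (U *t V) = 1%:M.
Proof. by move=> UU VV; rewrite trmx_tens tensmx_mul UU VV tens_scalar1. Qed.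

Lemma orthonormal1 {R : realDomainType} n :
  (1%:M : 'M[R]_n)^T *m 1%:M = 1%:M.
Proof. by rewrite trmx1 mulmx1. Qed.

Lemma const_mx1_scalar {R : realDomainType} : const_mx 1 = 1%:M :> 'M[R]_1.
Proof. by apply/matrixP => i j; rewrite !ord1 !mxE. Qed.

Lemma orthonormal_const1 {R : realDomainType} {n} : n = 1%N ->
  (const_mx 1 : 'M[R]_(1, n))^T *m const_mx 1 = 1%:M.
Proof. by move=> ->; rewrite const_mx1_scalar orthonormal1. Qed.

(** * Truncated singular value decompositions *)

(** Reduces statements on right singular vectors to left ones. *)
Lemma svdR_trmx {R : realType} {m n r} (A : 'M[R]_(m, n)) (V : 'M[R]_(n, r)) :
  is_svdR A V -> is_svdL A^T V.
Proof.
case=> le_rn [U [s [W [[UU WW s_ge0 s_dec ->] ->]]]].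
exists le_rn, W, s, U; split=> //; split=> //.
rewrite !trmx_mul trmxK mulmxA; congr (_ *m _ *m _).
apply/matrixP => i j; rewrite !mxE eq_sym.
by case: eqP => // ->.
Qed.

Lemma svdL_orthonormal {R : realType} {m n r} (A : 'M[R]_(m, n))
    (U : 'M[R]_(m, r)) : is_svdL A U -> U^T *m U = 1%:M.
Proof.
case=> le_rm [W [s [V [[WW _ _ _ _] ->]]]].
apply/matrixP => i j.
move/matrixP: WW => /(_ (widen_ord le_rm i) (widen_ord le_rm j)).
by rewrite !mxE => <-; apply: eq_bigr => k _; rewrite !mxE.
Qed.

(** A matrix with n <= r columns has at most r nonzero singular values, so its
column space is spanned by its first r left singular vectors. *)
Lemma svdL_factor {R : realType} {m n r} (A : 'M[R]_(m, n))
    (U : 'M[R]_(m, r)) : (n <= r)%N -> is_svdL A U ->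
  exists C : 'M_(r, n), A = U *m C.
Proof.
move=> le_nr [le_rm [W [s [V [[_ _ _ _ ->] ->]]]]].
exists ((\matrix_(i, j) (s i *+ (i == j :> nat))) *m V^T); rewrite mulmxA.
congr (_ *m _); apply/matrixP => i j; rewrite !mxE.
(* the rows k >= r of the diagonal factor vanish, since j < n <= r *)
rewrite (bigID (fun k : 'I_m => (k < r)%N)) /= [X in _ + X]big1 ?addr0; last first.
  move=> k; rewrite -leqNgt !mxE => le_rk.
  by rewrite gtn_eqF ?mulr0// (leq_trans (ltn_ord j))// (leq_trans le_nr).
by rewrite (big_ord_narrow le_rm); apply: eq_bigr => k _; rewrite !mxE.
Qed.

(** Truncation to r singular vectors is lossless on r columns: A = U C gives
U^T A = C, which has the energy of U C. *)
Lemma sqnorm_svdL {R : realType} {m n r} (A : 'M[R]_(m, n))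
    (U : 'M[R]_(m, r)) : (n <= r)%N -> is_svdL A U ->
  sqnorm (U^T *m A) = sqnorm A.
Proof.
move=> le_nr svdU; have UU := svdL_orthonormal _ _ svdU.
have [C ->] := svdL_factor _ _ le_nr svdU.
by rewrite mulmxA UU mul1mx sqnorm_isometry.
Qed.

Lemma sqnorm_svdR {R : realType} {m n r} (A : 'M[R]_(m, n))
    (V : 'M[R]_(n, r)) : (m <= r)%N -> is_svdR A V ->
  sqnorm (A *m V) = sqnorm A.
Proof.
move=> le_mr /svdR_trmx svdV.
by rewrite -sqnorm_tr trmx_mul (sqnorm_svdL _ _ le_mr svdV) sqnorm_tr.
Qed.

(** * Reshaping *)

Lemma sqnorm_reshape {R : realType} {q1 q2 q3} (A : 'M[R]_(q1, q3 * q2)) :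
  sqnorm (reshape_mx A) = sqnorm A.
Proof.
rewrite !sqnormE !pair_bigA /=.
pose f (x : 'I_(q2 * q1) * 'I_q3) :=
  ((mxtens_unindex x.1).2, mxtens_index (x.2, (mxtens_unindex x.1).1)).
pose g (y : 'I_q1 * 'I_(q3 * q2)) :=
  (mxtens_index ((mxtens_unindex y.2).2, y.1), (mxtens_unindex y.2).1).
have fK : cancel f g.
  case=> a i3; case: (mxtens_indexP a) => i2 i1.
  by rewrite /f /g !mxtens_indexK.
have gK : cancel g f.
  case=> i1 b; case: (mxtens_indexP b) => i3 i2.
  by rewrite /f /g !mxtens_indexK.
rewrite [RHS](reindex f) /=; last by exists g => ? _.
by apply: eq_bigr => x _; rewrite mxE.
Qed.

Lemma sum_mxtens {V : nmodType} {m n} (F : 'I_(m * n) -> V) :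
  \sum_b F b = \sum_i \sum_j F (mxtens_index (i, j)).
Proof.
rewrite pair_bigA (reindex (@mxtens_index m n)) /=.
  by apply: eq_bigr => -[].
by exists (@mxtens_unindex m n) => ? _; rewrite ?mxtens_indexK ?mxtens_unindexK.
Qed.

(** Reshaping moves the index of size q2 from the columns to the rows, so a factor
acting on the remaining column index acts before reshaping as [B *t 1]. *)
Lemma reshape_mulmxr {R : realType} {q1 q2 q3 n} (A : 'M[R]_(q1, q3 * q2))
    (B : 'M[R]_(q3, n)) :
  reshape_mx A *m B = reshape_mx (A *m (B *t (1%:M : 'M_q2))).
Proof.
apply/matrixP => a j; case: (mxtens_indexP a) => i2 i1.
rewrite !mxE mxtens_indexK /= sum_mxtens.
apply: eq_bigr => i _; rewrite (bigD1 i2) //= big1 => [|k ne_k]; last first.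
  by rewrite tensmxE !mxE (negPf ne_k) !mulr0.
by rewrite tensmxE !mxE mxtens_indexK eqxx mulr1 addr0.
Qed.

(** After reshaping, the rows carry the index of size q2 as their slow component,
on which a factor acting on the old row index does nothing. *)
Lemma reshape_mulmxl {R : realType} {q0 q1 q2 q3} (M : 'M[R]_(q0, q1))
    (A : 'M[R]_(q1, q3 * q2)) :
  reshape_mx (M *m A) = ((1%:M : 'M_q2) *t M) *m reshape_mx A.
Proof.
apply/matrixP => a j; case: (mxtens_indexP a) => i2 i1.
rewrite !mxE mxtens_indexK /= [RHS]sum_mxtens.
rewrite (bigD1 i2) //= [X in _ = _ + X]big1 => [|k ne_k]; last first.
  by rewrite big1 // => i _; rewrite tensmxE !mxE eq_sym (negPf ne_k) !mul0r.
rewrite addr0; apply: eq_bigr => i _.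
by rewrite tensmxE !mxE mxtens_indexK eqxx mul1r.
Qed.

(** * Unfoldings *)

Lemma ltn_digit q a b c : (a < q)%N -> (b < c)%N -> (a * c + b < q * c)%N.
Proof.
move=> lt_aq lt_bc; apply: (@leq_trans (a.+1 * c)).
  by rewrite mulSnr ltn_add2l.
by rewrite leq_mul2r lt_aq orbT.
Qed.

(** The component k of a multi-index is the slowest one among the rows of the
unfolding k + 1 and the fastest one among the columns of the unfolding k.
Together with [col_pos_rec], this turns questions on positions into
questions on Euclidean division. *)
Lemma row_pos_rec {d p} (I : multi_index d p) (k : 'I_d) :
  row_pos k.+1 I = (I k * pre p k + row_pos k I)%N.
Proof.
rewrite /row_pos (bigD1 k) //=; congr (_ * _ + _)%N; last first.
  by apply: eq_bigl => l; rewrite ltnS ltn_neqAle andbC.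
have: (k <= d)%N by apply: ltnW.
elim: (k : nat) => [|n IHn] lt_nd; first by rewrite big_pred0.
rewrite (bigD1 (Ordinal lt_nd)) //=; congr (_ * _)%N.
rewrite -IHn 1?ltnW//; apply: eq_bigl => l.
by rewrite ltnS ltn_neqAle andbC.
Qed.

Lemma col_pos_rec {d p} (I : multi_index d p) (k : 'I_d) :
  col_pos k I = (col_pos k.+1 I * p k.+1 + I k)%N.
Proof.
rewrite /col_pos (bigD1 k) //= addnC; congr (_ + _)%N; last first.
  by rewrite big_pred0 ?muln1// => m; rewrite leqNgt andNb.
rewrite big_distrl /=; apply: eq_big => [l|l /andP[le_kl ne_lk]].
  by rewrite [RHS]ltn_neqAle andbC eq_sym.
rewrite -mulnA; congr (_ * _)%N.
have lt_kl : (k < l)%N by rewrite ltn_neqAle le_kl eq_sym andbT.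
rewrite (bigD1 k) /= ?leqnn// mulnC; congr (_ * _)%N; apply: eq_bigl => m.
rewrite [(k < m)%N]ltn_neqAle -(val_eqE m k) [_ == (k : nat)]eq_sym.
by rewrite andbC !andbA.
Qed.

Lemma row_pos_lt {d p} (I : multi_index d p) k :
  (k <= d)%N -> (row_pos k I < pre p k)%N.
Proof.
elim: k => [|k IHk] lt_kd; first by rewrite /row_pos big_pred0.
have := row_pos_rec I (Ordinal lt_kd) => /= ->.
exact: ltn_digit (ltn_ord _) (IHk (ltnW lt_kd)).
Qed.

Lemma col_pos_lt {d p} (I : multi_index d p) k :
  (k <= d)%N -> (col_pos k I < suf d p k)%N.
Proof.
move=> le_kd; rewrite -(subKn le_kd); have := leq_subr k d.
(* columns are decoded from the last mode down: induction on d - k *)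
elim: (d - k)%N => [|n IHn] lt_nd.
  rewrite subn0 /suf subnn /col_pos big_pred0// => l.
  by rewrite leqNgt ltn_ord.
have lt_d : (d - n.+1 < d)%N by rewrite ltn_subrL (leq_ltn_trans _ lt_nd).
have := col_pos_rec I (Ordinal lt_d) => /= ->.
rewrite (suf_rec p lt_d) ltn_digit ?ltn_ord//.
by rewrite subnSK// IHn// ltnW.
Qed.

Lemma row_pos_inj {d p} (I J : multi_index d p) k : (k <= d)%N ->
  row_pos k I = row_pos k J -> forall l : 'I_d, (l < k)%N -> I l = J l.
Proof.
elim: k => // k IHk lt_kd eqIJ l; rewrite ltnS leq_eqVlt.
have := eqIJ; have := row_pos_rec I (Ordinal lt_kd).
have := row_pos_rec J (Ordinal lt_kd) => /= -> -> /eqP.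
rewrite eq_addl_mul ?(row_pos_lt _ _ (ltnW lt_kd))// xpair_eqE.
case/andP=> /eqP eq_k /eqP eq_pos /orP[/eqP eq_lk|]; last first.
  by apply: IHk => //; apply: ltnW.
have -> : l = Ordinal lt_kd by apply: val_inj.
exact: val_inj.
Qed.

Lemma col_pos_inj {d p} (I J : multi_index d p) k : (k <= d)%N ->
  col_pos k I = col_pos k J -> forall l : 'I_d, (k <= l)%N -> I l = J l.
Proof.
move=> le_kd; rewrite -(subKn le_kd); have := leq_subr k d.
elim: (d - k)%N => [|n IHn] lt_nd.
  by move=> _ l; rewrite subn0 leqNgt ltn_ord.
have lt_d : (d - n.+1 < d)%N by rewrite ltn_subrL (leq_ltn_trans _ lt_nd).
have := col_pos_rec I (Ordinal lt_d); have := col_pos_rec J (Ordinal lt_d).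
move=> /= -> -> /eqP; rewrite eq_addl_mul ?ltn_ord// xpair_eqE.
case/andP=> /eqP eq_pos /eqP eq_k l; rewrite leq_eqVlt => /orP[/eqP eq_lk|].
  have -> : l = Ordinal lt_d by apply: val_inj.
  exact: val_inj.
move=> lt_l; apply: IHn; first exact: ltnW.
  by rewrite -subnSK.
by rewrite -subnSK.
Qed.

Lemma unfolding_pos_inj {d p} k (I J : multi_index d p) : (k <= d)%N ->
  row_pos k I = row_pos k J -> col_pos k I = col_pos k J -> I = J.
Proof.
move=> le_kd eq_row eq_col; apply/ffunP => l.
case: (ltnP l k) => [|le_kl]; first exact: row_pos_inj eq_row l.
exact: col_pos_inj eq_col l le_kl.
Qed.

(** Multi-indices are mapped injectively to positions, so each entry of the
unfolding is a sum of at most one entry of X. *)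
Lemma sqnorm_unfolding {R : realType} {d p} k (X : tensor R d p) :
  (k <= d)%N -> sqnorm (unfolding k X) = frob X ^+ 2.
Proof.
move=> le_kd; rewrite /frob sqr_sqrtr; last first.
  by apply: sumr_ge0 => I _; apply: sqr_ge0.
rewrite sqnormE pair_bigA /=.
pose pos (I : multi_index d p) :=
  (Ordinal (row_pos_lt I _ le_kd), Ordinal (col_pos_lt I _ le_kd)).
rewrite [RHS](partition_big pos xpredT)//=; apply: eq_bigr => -[i j] _ /=.
rewrite mxE (eq_bigl (fun I => pos I == (i, j))) => [|I]; last first.
  by rewrite xpair_eqE.
case: (pickP (fun I => pos I == (i, j))) => [I posI|no_pos]; last first.
  by rewrite !big_pred0// expr0n.
have eqI J : (pos J == (i, j)) = (J == I).
  apply/eqP/eqP => [posJ|->]; last exact/eqP.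
  move: posJ; rewrite -(eqP posI) => -[eq_row eq_col].
  exact: unfolding_pos_inj _ _ _ le_kd eq_row eq_col.
by rewrite !(eq_bigl _ _ eqI) !big_pred1_eq.
Qed.

Lemma unfoldingB {R : realType} {d p} k (X Y : tensor R d p) :
  unfolding k (X - Y) = unfolding k X - unfolding k Y.
Proof.
apply/matrixP => i j; rewrite !mxE -sumrB; apply: eq_bigr => I _.
by rewrite !ffunE.
Qed.

(** The digit of one mode is split off the column position on one side and off
the row position on the other; by uniqueness of Euclidean division, both sides
select the same multi-indices. *)
Lemma reshape_unfolding {R : realType} {d p} k (lt_kd : (k < d)%N)
    (X : tensor R d p) :
  reshape_mx (split_cols lt_kd (unfolding k X)) = unfolding k.+1 X.
Proof.
apply/matrixP => a j; case: (mxtens_indexP a) => i2 i1.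
rewrite mxE castmxE !mxE !mxtens_indexK /=; apply: eq_bigl => I.
have := row_pos_rec I (Ordinal lt_kd); have := col_pos_rec I (Ordinal lt_kd).
move=> /= -> ->; rewrite !eq_addl_mul ?(row_pos_lt _ _ (ltnW lt_kd))//.
by rewrite !xpair_eqE andbCA andbC [X in X && _]andbC.
Qed.

(** * Sequential products *)

Lemma lprod_orthonormal {R : realType} {p r : nat -> nat}
    (M : forall k, 'M[R]_(p k * r k.-1, r k)) k : r 0%N = 1%N ->
  (forall j, (1 <= j <= k)%N -> (M j)^T *m M j = 1%:M) ->
  (lprod M k)^T *m lprod M k = 1%:M.
Proof.
move=> r0; elim: k => [|k IHk] orthoM; first exact: orthonormal_const1.
apply: orthonormal_mul; last by apply: (orthoM k.+1); rewrite /= leqnn.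
apply: orthonormal_tens; first exact: orthonormal1.
by apply: IHk => j /andP[j_gt0 le_jk]; rewrite orthoM// j_gt0 leqW.
Qed.

Lemma rprodn_orthonormal {R : realType} {p r : nat -> nat}
    (B : forall k, 'M[R]_(r k * p k, r k.-1)) k n : r (k + n)%N = 1%N ->
  (forall j, (k < j <= k + n)%N -> (B j)^T *m B j = 1%:M) ->
  (rprodn B k n)^T *m rprodn B k n = 1%:M.
Proof.
elim: n k => [|n IHn] k r1 orthoB.
  by apply: orthonormal_const1; rewrite addn0 in r1.
apply: orthonormal_mul; last first.
  by apply: (orthoB k.+1); rewrite ltnSn addnS ltnS leq_addr.
apply: orthonormal_tens; last exact: orthonormal1.
apply: IHn => [|j /andP[lt_kj le_j]]; first by rewrite addSnnS.
by apply: orthoB; rewrite ltnW//= -addSnnS.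
Qed.

Lemma rprod_orthonormal {R : realType} {d} {p r : nat -> nat}
    (B : forall k, 'M[R]_(r k * p k, r k.-1)) k : (k <= d)%N -> r d = 1%N ->
  (forall j, (k < j <= d)%N -> (B j)^T *m B j = 1%:M) ->
  (rprod d B k.+1)^T *m rprod d B k.+1 = 1%:M.
Proof.
move=> le_kd rd orthoB; apply: rprodn_orthonormal; first by rewrite subnKC.
by move=> j; rewrite subnKC//; apply: orthoB.
Qed.

(** The recursion that defines the right products. It is multiplied by A on the
left so that the identification of dimensions it needs becomes a cast of A, the
one found in a backward update. *)
Lemma mul_rprod_rec {R : realType} {d} {p r : nat -> nat}
    (B : forall k, 'M[R]_(r k * p k, r k.-1)) {k m} (lt_kd : (k < d)%N)
    (A : 'M[R]_(m, suf d p k)) :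
  split_cols lt_kd A *m (rprod d B k.+2 *t (1%:M : 'M[R]_(p k.+1))) *m B k.+1
  = A *m rprod d B k.+1.
Proof.
rewrite /split_cols /rprod /=; move: (suf_rec p lt_kd) A; rewrite /suf.
(* once d - k is a successor, both sides of suf_rec are convertible *)
have: (d - k = (d - k.+1).+1)%N by rewrite subnSK.
move: (d - k.+1)%N (d - k)%N => n _ -> e A.
by rewrite castmx_id -mulmxA.
Qed.

(** At the last mode, the remaining right product is the identity of size
r_d = 1. *)
Lemma sqnorm_mul_rprod_end {R : realType} {d} {p r : nat -> nat}
    (B : forall k, 'M[R]_(r k * p k, r k.-1)) {k m} (lt_kd : (k < d)%N)
    (A : 'M[R]_(m, suf d p k)) : k.+1 = d -> r d = 1%N ->
  sqnorm (split_cols lt_kd A *m (rprod d B k.+2 *t (1%:M : 'M[R]_(p k.+1))))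
  = sqnorm A.
Proof.
move=> k1d; subst d => rd.
rewrite -[RHS](sqnorm_cast (erefl m, suf_rec p lt_kd)).
rewrite -sqnorm_tr trmx_mul sqnorm_isometry ?sqnorm_tr// trmxK -{1}trmx1.
rewrite trmx_tens !trmx1 tensmx_mul mulmx1 -[RHS]tens_scalar1; congr (_ *t _).
rewrite /rprod /suf /=; have: (k.+1 - k.+1 = 0)%N by rewrite subnn.
move: (k.+1 - k.+1)%N => _ -> /=; rewrite -[X in X *m _]trmxK trmx_const.
by move: (r k.+1) rd => _ ->; rewrite const_mx1_scalar !trmx1 mulmx1.
Qed.

(** With q = r_0 = 1, this expresses the cast of the first unfolding as a product
of the same shape as at the later steps of a forward sweep. *)
Lemma castmx_left_unit {R : realType} {m q n} (q1 : q = 1%N)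
    (e : (m * 1 = m * q)%N) (A : 'M[R]_(m * 1, n)) :
  castmx (e, erefl n) A = ((1%:M : 'M_m) *t (const_mx 1 : 'M_(1, q)))^T *m A.
Proof.
subst q; rewrite castmx_id const_mx1_scalar tens_scalar1.
by rewrite trmx1 mul1mx.
Qed.

Lemma sqnorm_castl_mul {R : realDomainType} {m m' n q} (e : m = m')
    (A : 'M[R]_(m, n)) (B : 'M[R]_(n, q)) :
  sqnorm (castmx (e, erefl n) A *m B) = sqnorm (A *m B).
Proof. by case: m' / e; rewrite castmx_id. Qed.

(** * Outcomes of the sweeps *)

Lemma frob_projection {R : realType} {d p} k (X Y : tensor R d p) {q}
    (U : 'M[R]_(pre p k, q)) : (k <= d)%N -> U^T *m U = 1%:M ->
  unfolding k X = U *m (U^T *m unfolding k Y) ->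
  frob (Y - X) ^+ 2 = frob Y ^+ 2 - frob X ^+ 2.
Proof.
move=> le_kd UU defX; rewrite -!(sqnorm_unfolding k)// unfoldingB defX.
by rewrite sqnorm_residual// [in RHS]sqnorm_isometry.
Qed.

Lemma frob_projection_right {R : realType} {d p} k (X Y : tensor R d p) {q}
    (V : 'M[R]_(suf d p k, q)) : (k <= d)%N -> V^T *m V = 1%:M ->
  unfolding k X = unfolding k Y *m V *m V^T ->
  frob (Y - X) ^+ 2 = frob Y ^+ 2 - frob X ^+ 2.
Proof.
move=> le_kd VV defX; rewrite -!(sqnorm_unfolding k)// unfoldingB.
rewrite -sqnorm_tr -(sqnorm_tr (unfolding k X)) -(sqnorm_tr (unfolding k Y)).
rewrite linearB /= defX !trmx_mul trmxK.
by rewrite sqnorm_residual// [in RHS]sqnorm_isometry.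
Qed.

Lemma Uhat_orthonormal {R : realType} {d} {p r : nat -> nat} {r0 : r 0%N = 1%N}
    {Y : tensor R d p} (run : ttoi_run r0 Y) t k :
  ~~ odd t -> (1 <= k < d)%N -> (Uhat run t k)^T *m Uhat run t k = 1%:M.
Proof.
move=> even_t k_in; case: t even_t => [|[|t]]// even_t.
  exact: (svdL_orthonormal _ _ (ttoi_U_init run k_in)).
by apply: (svdL_orthonormal _ _ (ttoi_U_forward run even_t _ k_in)).
Qed.

Lemma Vhat_orthonormal {R : realType} {d} {p r : nat -> nat} {r0 : r 0%N = 1%N}
    {Y : tensor R d p} (run : ttoi_run r0 Y) t k :
  odd t -> (1 < k <= d)%N -> (Vhat run t k)^T *m Vhat run t k = 1%:M.
Proof.
move=> odd_t; case: k => // k /andP[k_gt0 lt_kd].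
have /svdR_trmx := ttoi_V_backward run lt_kd odd_t k_gt0.
exact: svdL_orthonormal.
Qed.

(** A forward sweep compresses the successive unfoldings of Y: R_(k+1) is
(1 *t L_k)^T Y_(k+1) by induction, since reshaping commutes with both the passage
from Y_k to Y_(k+1) and the multiplication by L_k^T. *)
Lemma Rtil_lprod {R : realType} {d} {p r : nat -> nat} {r0 : r 0%N = 1%N}
    {Y : tensor R d p} (run : ttoi_run r0 Y) t k : ~~ odd t -> (1 <= k < d)%N ->
  Rtil run t k = (lprod (Uhat run t) k)^T *m unfolding k Y.
Proof.
move=> even_t; case: k => // k /= lt_kd; rewrite (ttoi_Rtil run)//.
suff -> : Rmat run t k.+1 = ((1%:M : 'M_(p k.+1)) *t lprod (Uhat run t) k)^T
                            *m unfolding k.+1 Y.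
  by rewrite mulmxA -trmx_mul.
elim: k lt_kd => [|k IHk] lt_kd.
  by rewrite (ttoi_R1 run)//; apply: castmx_left_unit.
have lt_k1d := ltnW lt_kd.
rewrite (ttoi_RS run lt_k1d) ?ltn_predRL// (ttoi_Rtil run)// IHk//.
rewrite mulmxA -trmx_mul -(reshape_unfolding k.+1 lt_k1d).
rewrite trmx_tens trmx1 -reshape_mulmxl; congr reshape_mx.
by rewrite /split_cols castmx_mul castmx_id.
Qed.

Lemma lprod_Uhat_orthonormal {R : realType} {d} {p r : nat -> nat}
    {r0 : r 0%N = 1%N} {Y : tensor R d p} (run : ttoi_run r0 Y) t k :
  ~~ odd t -> (k < d)%N ->
  (lprod (Uhat run t) k)^T *m lprod (Uhat run t) k = 1%:M.
Proof.
move=> even_t lt_kd; apply: lprod_orthonormal => // j /andP[j_gt0 le_jk].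
by apply: Uhat_orthonormal; rewrite // j_gt0 (leq_ltn_trans le_jk).
Qed.

Lemma rprod_Vhat_orthonormal {R : realType} {d} {p r : nat -> nat}
    {r0 : r 0%N = 1%N} {Y : tensor R d p} (run : ttoi_run r0 Y) t k :
  r d = 1%N -> odd t -> (1 <= k <= d)%N ->
  (rprod d (Vhat run t) k.+1)^T *m rprod d (Vhat run t) k.+1 = 1%:M.
Proof.
move=> rd odd_t /andP[k_gt0 le_kd]; apply: rprod_orthonormal => // j.
case/andP=> lt_kj le_jd.
by apply: Vhat_orthonormal; rewrite // le_jd (leq_ltn_trans k_gt0).
Qed.

Lemma frob_Xhat_odd {R : realType} {d} {p r : nat -> nat} {r0 : r 0%N = 1%N}
    {Y : tensor R d p} (run : ttoi_run r0 Y) t :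
  (1 < d)%N -> r d = 1%N -> odd t ->
  frob (Xhat run t) ^+ 2 = sqnorm (unfolding 1 Y *m rprod d (Vhat run t) 2).
Proof.
move=> d_gt1 rd odd_t; rewrite -(sqnorm_unfolding 1) 1?ltnW//.
rewrite (ttoi_X_backward run)// -sqnorm_tr trmx_mul trmxK sqnorm_isometry.
  exact: sqnorm_tr.
by apply: rprod_Vhat_orthonormal; rewrite //= ltnW.
Qed.

Lemma frob_Xhat_even {R : realType} {d} {p r : nat -> nat} {r0 : r 0%N = 1%N}
    {Y : tensor R d p} (run : ttoi_run r0 Y) t : (1 < d)%N -> ~~ odd t ->
  frob (Xhat run t) ^+ 2 = sqnorm (Rtil run t d.-1).
Proof.
move=> d_gt1 even_t; rewrite -(sqnorm_unfolding d.-1) ?leq_pred//.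
rewrite (ttoi_X_forward run)// sqnorm_isometry//.
by apply: lprod_Uhat_orthonormal; rewrite // ltn_predL ltnW.
Qed.

Lemma frob_Xhat_residual {R : realType} {d} {p r : nat -> nat}
    {r0 : r 0%N = 1%N} {Y : tensor R d p} (run : ttoi_run r0 Y) t :
  (1 < d)%N -> r d = 1%N ->
  frob (Y - Xhat run t) ^+ 2 = frob Y ^+ 2 - frob (Xhat run t) ^+ 2.
Proof.
move=> d_gt1 rd; have d_gt0 := ltnW d_gt1; case: (boolP (odd t)) => par_t.
  apply: (frob_projection_right 1 _ _ _ _ _ (ttoi_X_backward run par_t)) => //.
  exact: rprod_Vhat_orthonormal.
have lt_d : (d.-1 < d)%N by rewrite ltn_predL.
apply: (frob_projection d.-1 _ _ _ _ (lprod_Uhat_orthonormal run t _ par_t lt_d)).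
  exact: ltnW.
by rewrite -Rtil_lprod ?(ttoi_X_forward run)// lt_d andbT ltn_predRL.
Qed.

(** * Comparison of consecutive sweeps *)

(** The link of the chain of energies that passes from the mode k to the mode
k + 1: R_(k+1) is the reshaping of Rtil_k. *)
Lemma sqnorm_Rtil_Rmat {R : realType} {d} {p r : nat -> nat} {r0 : r 0%N = 1%N}
    {Y : tensor R d p} (run : ttoi_run r0 Y) s u k (lt_kd : (k < d)%N) :
  ~~ odd s -> (1 <= k)%N -> (k.+1 < d)%N ->
  sqnorm (split_cols lt_kd (Rtil run s k) *m
            (rprod d (Vhat run u) k.+2 *t (1%:M : 'M_(p k.+1))))
  = sqnorm (Rmat run s k.+1 *m rprod d (Vhat run u) k.+2).
Proof.
move=> even_s k_gt0 lt_k1d.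
rewrite (ttoi_RS run lt_kd) ?k_gt0 ?ltn_predRL//.
by rewrite reshape_mulmxr sqnorm_reshape.
Qed.

(** U_k is computed from R_k B_(k+1) and preserves its energy (keep), while
leaving out the older factor V_(k+1) can only increase the energy (drop): from
Y_1 B_2 to Rtil_(d-1), no link of the chain loses energy. *)
Lemma forward_sweep_le {R : realType} {d} {p r : nat -> nat} {r0 : r 0%N = 1%N}
    {Y : tensor R d p} (run : ttoi_run r0 Y) t :
  (1 < d)%N -> r d = 1%N -> odd t ->
  sqnorm (unfolding 1 Y *m rprod d (Vhat run t) 2)
    <= sqnorm (Rtil run t.+1 d.-1).
Proof.
move=> d_gt1 rd odd_t; have even_t1 : ~~ odd t.+1 by rewrite /= negbK.
have t1_ge2 : (2 <= t.+1)%N by case: (t) odd_t.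
pose B := Vhat run t.
have keep k : (1 <= k < d)%N -> sqnorm (Rtil run t.+1 k *m rprod d B k.+1)
                              = sqnorm (Rmat run t.+1 k *m rprod d B k.+1).
  move=> k_in; rewrite (ttoi_Rtil run)// -mulmxA.
  exact: (sqnorm_svdL _ _ _ (ttoi_U_forward run even_t1 t1_ge2 k_in)).
have drop k (lt_kd : (k < d)%N) : (1 <= k)%N ->
    sqnorm (Rtil run t.+1 k *m rprod d B k.+1)
    <= sqnorm (split_cols lt_kd (Rtil run t.+1 k) *m
                 (rprod d B k.+2 *t (1%:M : 'M_(p k.+1)))).
  move=> k_gt0; rewrite -(mul_rprod_rec B lt_kd); apply: sqnorm_mul_le.
  by apply: (Vhat_orthonormal run t k.+1); rewrite ?ltnS ?k_gt0.
have chain k : (1 <= k < d)%N -> sqnorm (unfolding 1 Y *m rprod d B 2)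
                               <= sqnorm (Rtil run t.+1 k *m rprod d B k.+1).
  elim: k => // -[|k] IHk lt_kd.
    by rewrite keep// (ttoi_R1 run)// sqnorm_castl_mul.
  have lt_k1d := ltnW lt_kd; apply: le_trans (IHk lt_k1d) _.
  rewrite [leRHS]keep// -(sqnorm_Rtil_Rmat run t.+1 t k.+1 lt_k1d)//.
  exact: drop.
have d1_in : (1 <= d.-1 < d)%N by rewrite ltn_predRL d_gt1 ltn_predL ltnW.
have [d1_gt0 lt_d] := andP d1_in.
apply: le_trans (chain _ d1_in) _; apply: le_trans (drop _ lt_d d1_gt0) _.
by rewrite sqnorm_mul_rprod_end// prednK// ltnW.
Qed.

(** The same chain in the opposite direction: V_(k+1) is now the factor that
preserves the energy (keep), and leaving out the older factor U_k^T can only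
increase it (drop). *)
Lemma backward_sweep_le {R : realType} {d} {p r : nat -> nat} {r0 : r 0%N = 1%N}
    {Y : tensor R d p} (run : ttoi_run r0 Y) t :
  (1 < d)%N -> r d = 1%N -> ~~ odd t ->
  sqnorm (Rtil run t d.-1)
    <= sqnorm (unfolding 1 Y *m rprod d (Vhat run t.+1) 2).
Proof.
move=> d_gt1 rd even_t; have odd_t1 : odd t.+1 by [].
pose B := Vhat run t.+1.
have keep k (lt_kd : (k < d)%N) : (1 <= k)%N ->
    sqnorm (Rtil run t k *m rprod d B k.+1)
    = sqnorm (split_cols lt_kd (Rtil run t k) *m
                (rprod d B k.+2 *t (1%:M : 'M_(p k.+1)))).
  move=> k_gt0; rewrite -(mul_rprod_rec B lt_kd); apply: sqnorm_svdR => //.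
  exact: (ttoi_V_backward run lt_kd odd_t1).
have drop k : (1 <= k < d)%N -> sqnorm (Rtil run t k *m rprod d B k.+1)
                              <= sqnorm (Rmat run t k *m rprod d B k.+1).
  move=> k_in; rewrite (ttoi_Rtil run)// -mulmxA.
  exact: (sqnorm_mul_trmx_le _ _ (Uhat_orthonormal run t k even_t k_in)).
have chain k : (1 <= k < d)%N -> sqnorm (Rtil run t k *m rprod d B k.+1)
                               <= sqnorm (unfolding 1 Y *m rprod d B 2).
  elim: k => // -[|k] IHk lt_kd.
    by rewrite (le_trans (drop _ _))// (ttoi_R1 run)// sqnorm_castl_mul.
  have lt_k1d := ltnW lt_kd; apply: le_trans (IHk lt_k1d).
  rewrite [leRHS](keep k.+1 lt_k1d)// sqnorm_Rtil_Rmat//.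
  exact: drop.
have d1_in : (1 <= d.-1 < d)%N by rewrite ltn_predRL d_gt1 ltn_predL ltnW.
have [d1_gt0 lt_d] := andP d1_in.
apply: le_trans (chain _ d1_in); rewrite (keep _ lt_d)//.
by rewrite sqnorm_mul_rprod_end// prednK// ltnW.
Qed.

Theorem theorem3p2 (R : realType) (d : nat) (p r : nat -> nat)
    (d_ge2 : (2 <= d)%N)
    (p_gt0 : forall k, (1 <= k <= d)%N -> (0 < p k)%N)
    (r_gt0 : forall k, (1 <= k < d)%N -> (0 < r k)%N)
    (r0 : r 0%N = 1%N) (rd : r d = 1%N)
    (r_le_fwd : forall k, (1 <= k <= d)%N -> (r k <= r k.-1 * p k)%N)
    (r_le_bwd : forall k, (1 <= k <= d)%N -> (r k.-1 <= p k * r k)%N)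
    (Y : tensor R d p) (run : ttoi_run r0 Y) (t : nat) (t_ge1 : (1 <= t)%N) :
  frob Y ^+ 2 - frob (Xhat run t.+1) ^+ 2 <= frob Y ^+ 2 - frob (Xhat run t) ^+ 2
  /\ frob (Y - Xhat run t.+1) ^+ 2 = frob Y ^+ 2 - frob (Xhat run t.+1) ^+ 2.
Proof.
split; last exact: frob_Xhat_residual.
rewrite lerD2l lerN2; case: (boolP (odd t)) => par_t.
  rewrite frob_Xhat_odd// frob_Xhat_even//= ?negbK//.
  exact: forward_sweep_le.
by rewrite frob_Xhat_even// frob_Xhat_odd//; apply: backward_sweep_le.
Qed.
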